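(* Let $\mathcal{X} \subset \mathbb{R}^n$, let $\mathcal{J} = \{1,\dots,p\}$, and let $a_i : \mathcal{X} \to \mathbb{R}^m$, $b_i : \mathcal{X} \to \mathbb{R}$ ($i \in \mathcal{J}$) and $\pi_{\rm des} : \mathcal{X} \to \mathbb{R}^m$ be Lipschitz continuous on $\mathcal{X}$, with $\|a_i(x)\| = 1$ for all $x \in \mathcal{X}$ and $i \in \mathcal{J}$. Let $K(x) = \{u \in \mathbb{R}^m : a_i(x)^\top u \le b_i(x)\ \forall i \in \mathcal{J}\}$. Let $\pi_{\rm f} : \mathcal{X} \to \mathbb{R}^m$ be Lipschitz continuous on $\mathcal{X}$ with $\pi_{\rm f}(x) \in K(x)$ for all $x \in \mathcal{X}$, and suppose there exists $\overline{U}_{\rm f} > 0$ with $\|\pi_{\rm f}(x)\| \le \overline{U}_{\rm f}$ for all $x \in \mathcal{X}$. Set $r(x) = \min_{i \in \mathcal{J}} \big(b_i(x) - a_i(x)^\top \pi_{\rm f}(x)\big)$ and consider, for each $x \in \mathcal{X}$, the problem $$\min_{u \in \mathbb{R}^m} \ \|u - \pi_{\rm des}(x)\|^2 \quad \text{subject to} \quad \|u - \pi_{\rm f}(x)\| \le r(x). \tag{P}$$ Then: 1. for every $x \in \mathcal{X}$ there exists a unique minimizer of (P); denote it by $\pi_{\rm socp}(x)$, which defines a function $\pi_{\rm socp} : \mathcal{X} \to \mathbb{R}^m$; 2. $\pi_{\rm socp}(x) \in K(x)$ for all $x \in \mathcal{X}$; 3. $\pi_{\rm socp}$ is Lipschitz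 continuous on $\mathcal{X}$.
   Context: $\|\cdot\|$ is the Euclidean norm; $m, n, p \ge 1$ are integers. A function $f : \mathcal{X} \to \mathbb{R}^k$ is Lipschitz continuous on $\mathcal{X}$ if there is $L \ge 0$ with $\|f(x_1) - f(x_2)\| \le L\|x_1 - x_2\|$ for all $x_1, x_2 \in \mathcal{X}$. *)

(* Defs.v *)
From mathcomp Require Import all_boot all_order all_algebra.
From mathcomp Require Import boolp classical_sets reals.

Set Implicit Arguments.
Unset Strict Implicit.
Unset Printing Implicit Defensive.

Import Order.TTheory GRing.Theory Num.Theory.

Local Open Scope classical_set_scope.
Local Open Scope ring_scope.

Definition dotp (R : realType) (k : nat) (u v : 'cV[R]_k) : R :=
  (u^T *m v) ord0 ord0.

(* The norm that MathComp-Analysis puts on matrices is the sup norm, hence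
   this definition. *)
Definition enorm (R : realType) (k : nat) (u : 'cV[R]_k) : R :=
  Num.sqrt (\sum_(i < k) u i ord0 ^+ 2).

(* A function from X to R^k is a total function of which only the values on X
   matter; f is never evaluated outside X here. A real-valued g is covered by
   k = 1, as fun x => (g x)%:M. *)
Definition lipschitz_continuous_on (R : realType) (n k : nat)
    (X : set 'cV[R]_n) (f : 'cV[R]_n -> 'cV[R]_k) : Prop :=
  exists2 L : R, 0 <= L &
    forall x1 x2 : 'cV[R]_n, X x1 -> X x2 ->
      enorm (f x1 - f x2) <= L * enorm (x1 - x2).

Definition polyhedron (R : realType) (n m p : nat)
    (a : 'I_p -> 'cV[R]_n -> 'cV[R]_m) (b : 'I_p -> 'cV[R]_n -> R)
    (x : 'cV[R]_n) : set 'cV[R]_m :=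
  [set u | forall i : 'I_p, dotp (a i x) u <= b i x].

(* \big[Num.min/d] takes the minimum of the family and of the default d; with
   d a member of the family (here of index 0, available since 0 < p), this is
   the minimum of the family. *)
Definition family_min (R : realType) (p : nat) (hp : (0 < p)%N)
    (F : 'I_p -> R) : R :=
  \big[Num.min/F (Ordinal hp)]_(i < p) F i.

Definition safety_radius (R : realType) (n m p : nat) (hp : (0 < p)%N)
    (a : 'I_p -> 'cV[R]_n -> 'cV[R]_m) (b : 'I_p -> 'cV[R]_n -> R)
    (pif : 'cV[R]_n -> 'cV[R]_m) (x : 'cV[R]_n) : R :=
  family_min hp (fun i => b i x - dotp (a i x) (pif x)).

Definition is_minimizer (R : realType) (T : Type) (C : set T) (J : T -> R)
    (u : T) : Prop :=
  C u /\ forall v : T, C v -> J u <= J v.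

Definition socp_minimizer (R : realType) (n m p : nat) (hp : (0 < p)%N)
    (a : 'I_p -> 'cV[R]_n -> 'cV[R]_m) (b : 'I_p -> 'cV[R]_n -> R)
    (pif pides : 'cV[R]_n -> 'cV[R]_m) (x : 'cV[R]_n) (u : 'cV[R]_m) : Prop :=
  is_minimizer [set v | enorm (v - pif x) <= safety_radius hp a b pif x]
    (fun v => enorm (v - pides x) ^+ 2) u.

(* Main.v *)
(** The minimizer of (P) is the projection of pi_des(x) onto the ball of centre
pi_f(x) and radius r(x). Since the a_i(x) are unit vectors, Cauchy-Schwarz puts
this ball inside K(x). The projection of d onto the centred ball of radius r is
nonexpansive in d (by the variational inequality) and 1-Lipschitz in r (it
equals min(|d|, r) d / |d|). The radius r(x) is Lipschitz, being a minimum of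
finitely many Lipschitz functions: the products a_i . pi_f are Lipschitz because
both factors are bounded. *)

Require Import Defs.
From mathcomp Require Import all_boot all_order all_algebra.
From mathcomp Require Import boolp classical_sets reals.
From mathcomp Require Import ring lra.

Set Implicit Arguments.
Unset Strict Implicit.
Unset Printing Implicit Defensive.

Import Order.TTheory GRing.Theory Num.Theory.

Local Open Scope classical_set_scope.
Local Open Scope ring_scope.

(** * Inner product and Euclidean norm on column vectors *)

Section Euclidean.

Variables (R : realType) (k : nat).
Implicit Types (u v w d : 'cV[R]_k) (c r s : R).

Lemma dotpE u v : dotp u v = \sum_(i < k) u i ord0 * v i ord0.
Proof. by rewrite /dotp mxE; apply: eq_bigr => i _; rewrite mxE. Qed.

Lemma dotpC u v : dotp u v = dotp v u.
Proof. by rewrite !dotpE; apply: eq_bigr => i _; rewrite mulrC. Qed.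

Lemma dotpDl u v w : dotp (u + v) w = dotp u w + dotp v w.
Proof. by rewrite /dotp linearD mulmxDl mxE. Qed.

Lemma dotpZl c u v : dotp (c *: u) v = c * dotp u v.
Proof. by rewrite /dotp linearZ -scalemxAl mxE. Qed.

Lemma dotpNl u v : dotp (- u) v = - dotp u v.
Proof. by rewrite -scaleN1r dotpZl mulN1r. Qed.

Lemma dotpDr u v w : dotp w (u + v) = dotp w u + dotp w v.
Proof. by rewrite dotpC dotpDl !(dotpC w). Qed.

Lemma dotpZr c u v : dotp v (c *: u) = c * dotp v u.
Proof. by rewrite dotpC dotpZl dotpC. Qed.

Lemma dotpNr u v : dotp v (- u) = - dotp v u.
Proof. by rewrite dotpC dotpNl dotpC. Qed.

Definition dotp_lin := (dotpDl, dotpDr, dotpNl, dotpNr, dotpZl, dotpZr).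

Lemma enorm_ge0 u : 0 <= enorm u.
Proof. exact: sqrtr_ge0. Qed.

Lemma enorm_sqr u : enorm u ^+ 2 = dotp u u.
Proof.
rewrite sqr_sqrtr ?dotpE; first by apply: eq_bigr => i _; rewrite expr2.
by apply: sumr_ge0 => i _; exact: sqr_ge0.
Qed.

Lemma enorm_eq0 u : enorm u = 0 -> u = 0.
Proof.
move=> /eqP; rewrite sqrtr_eq0 => le0.
have s0 : \sum_(i < k) u i ord0 ^+ 2 = 0.
  by apply/eqP; rewrite eq_le le0 sumr_ge0 // => i _; exact: sqr_ge0.
apply/matrixP => i j; rewrite ord1 mxE; apply/eqP.
rewrite -sqrf_eq0; apply/eqP.
by apply: (psumr_eq0P _ s0) => // l _; exact: sqr_ge0.
Qed.

Lemma enormZ c u : enorm (c *: u) = `|c| * enorm u.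
Proof.
apply/eqP; rewrite -(@eqrXn2 _ 2) ?mulr_ge0 ?enorm_ge0 //.
by rewrite exprMn !enorm_sqr !dotp_lin real_normK ?num_real // mulrA expr2.
Qed.

Lemma enormN u : enorm (- u) = enorm u.
Proof. by rewrite -scaleN1r enormZ normrN1 mul1r. Qed.

(** Cauchy-Schwarz: for nonzero [u] and [v], the square of the norm of [enorm v *: u - enorm u *: v]
    expands to twice [enorm u * enorm v] times the gap in the inequality. *)
Lemma dotp_le u v : dotp u v <= enorm u * enorm v.
Proof.
have [u0|u0] := eqVneq (enorm u) 0.
  by rewrite u0 mul0r (enorm_eq0 u0) -(scale0r 0) dotpZl mul0r.
have [v0|v0] := eqVneq (enorm v) 0.
  by rewrite v0 mulr0 (enorm_eq0 v0) -(scale0r 0) dotpZr mul0r.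
have uv_gt0 : 0 < enorm u * enorm v by rewrite mulr_gt0 // lt0r ?u0 ?v0 enorm_ge0.
rewrite -(ler_pM2l uv_gt0).
have := sqr_ge0 (enorm (enorm v *: u - enorm u *: v)).
rewrite enorm_sqr !dotp_lin -!enorm_sqr (dotpC v u); nra.
Qed.

Lemma normr_dotp_le u v : `|dotp u v| <= enorm u * enorm v.
Proof. by rewrite ler_norml lerNl -dotpNl -{1}(enormN u) !dotp_le. Qed.

Lemma enormD u v : enorm (u + v) <= enorm u + enorm v.
Proof.
rewrite -(@ler_pXn2r _ 2) ?nnegrE ?addr_ge0 ?enorm_ge0 //.
have := dotp_le u v.
rewrite sqrrD !enorm_sqr !dotp_lin (dotpC v u); lra.
Qed.

(** * Projection onto a centred ball *)

Definition ball_proj r d := if enorm d <= r then d else (r / enorm d) *: d.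

Lemma ball_proj_norm r d : 0 <= r -> enorm (ball_proj r d) <= r.
Proof.
move=> r0; rewrite /ball_proj; case: (leP (enorm d) r) => // rd.
have d0 : 0 < enorm d by exact: le_lt_trans r0 rd.
by rewrite enormZ ger0_norm ?divr_ge0 ?enorm_ge0 // divfK ?gt_eqF.
Qed.

(** Outside the ball the residual is a nonnegative multiple of [d], and [dotp d v <= enorm d * r] by
    Cauchy-Schwarz, with equality at the projection. *)
Lemma ball_proj_variational r d v : 0 <= r -> enorm v <= r ->
  dotp (d - ball_proj r d) (v - ball_proj r d) <= 0.
Proof.
move=> r0 vr; rewrite /ball_proj; case: (leP (enorm d) r) => [_|rd].
  by rewrite subrr -(scale0r 0) dotpZl mul0r.
have d0 : 0 < enorm d by exact: le_lt_trans r0 rd.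
have t1 : 0 <= 1 - r / enorm d by rewrite subr_ge0 ler_pdivrMr // mul1r ltW.
rewrite -{1}(scale1r d) -scalerBl dotpZl mulr_ge0_le0 //.
rewrite !dotp_lin -enorm_sqr expr2 mulrA divfK ?gt_eqF //.
rewrite subr_le0 mulrC; apply: le_trans (dotp_le _ _) _.
by rewrite ler_wpM2l ?enorm_ge0.
Qed.

(** Expanding the right side around the projection leaves a cross term whose sign is the variational
    inequality. Keeping the second square gives uniqueness as well as minimality. *)
Lemma ball_proj_dist r d v : 0 <= r -> enorm v <= r ->
  enorm (ball_proj r d - d) ^+ 2 + enorm (v - ball_proj r d) ^+ 2
    <= enorm (v - d) ^+ 2.
Proof.
move=> r0 vr; have := ball_proj_variational d r0 vr.
move: (ball_proj r d) => q; rewrite !enorm_sqr !dotp_lin.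
rewrite (dotpC v d) (dotpC q d) (dotpC v q); lra.
Qed.

Lemma ball_proj_nonexpansive r d e : 0 <= r ->
  enorm (ball_proj r d - ball_proj r e) <= enorm (d - e).
Proof.
move=> r0.
have := ball_proj_variational d r0 (ball_proj_norm e r0).
have := ball_proj_variational e r0 (ball_proj_norm d r0).
move: (ball_proj r d) (ball_proj r e) => p q Hq Hp.
(* The sum of the two variational inequalities, each tested at the other projection, bounds the
   squared norm of [p - q] by [dotp (d - e) (p - q)]. *)
have : enorm (p - q) * enorm (p - q) <= enorm (d - e) * enorm (p - q).
  apply: le_trans (dotp_le _ _); rewrite -expr2 enorm_sqr.
  move: Hp Hq; rewrite !dotp_lin (dotpC q p); lra.
have [->|pq] := eqVneq (enorm (p - q)) 0; first by rewrite enorm_ge0.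
by rewrite ler_pM2r // lt0r pq enorm_ge0.
Qed.

(** This form has no case split on [r], so projections of one [d] onto two balls subtract as
    multiples of [d]. Division by zero is harmless, since [d = 0] then. *)
Lemma ball_projE r d : 0 <= r ->
  ball_proj r d = (Num.min (enorm d) r / enorm d) *: d.
Proof.
rewrite /ball_proj => r0; case: (leP (enorm d) r) => // _.
have [/enorm_eq0 ->|d0] := eqVneq (enorm d) 0; first by rewrite scaler0.
by rewrite divff // scale1r.
Qed.

Lemma ball_proj_radius_lipschitz r s d : 0 <= r -> 0 <= s ->
  enorm (ball_proj r d - ball_proj s d) <= `|r - s|.
Proof.
move=> r0 s0; rewrite !ball_projE // -scalerBl enormZ -mulrBl.
have [->|d0] := eqVneq (enorm d) 0; first by rewrite mulr0.
rewrite normrM normfV (ger0_norm (enorm_ge0 d)) divfK //.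
move: (enorm d) => t; have := ler_norm (r - s).
have := ler_norm (s - r); rewrite (distrC s r) => sr rs.
by rewrite ler_norml; case: (leP t r); case: (leP t s); lra.
Qed.

Lemma ball_proj_lipschitz r s d e : 0 <= r -> 0 <= s ->
  enorm (ball_proj r d - ball_proj s e) <= enorm (d - e) + `|r - s|.
Proof.
(* The intermediate point changes the projected vector first, then the radius. *)
move=> r0 s0; rewrite -(subrKA (ball_proj r e)).
apply: le_trans (enormD _ _) (lerD _ _).
  exact: ball_proj_nonexpansive.
exact: ball_proj_radius_lipschitz.
Qed.

End Euclidean.

Lemma enorm_scalar (R : realType) (c : R) : enorm (c%:M : 'cV[R]_1) = `|c|.
Proof. by rewrite /enorm big_ord1 mxE mulr1n sqrtr_sqr. Qed.

(** * Minimum of a finite family *)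

Section FamilyMin.

Variables (R : realType) (p : nat) (hp : (0 < p)%N).
Implicit Types F G : 'I_p -> R.

Lemma family_min_le F i : family_min hp F <= F i.
Proof. exact: bigmin_le. Qed.

(** The default of the iterated minimum is itself a value of [F], so the hypothesis covers it
    too. *)
Lemma le_family_min F c : (forall i, c <= F i) -> c <= family_min hp F.
Proof. by move=> cF; apply/bigmin_geP; split. Qed.

Lemma family_min_dist F G D : (forall i, `|F i - G i| <= D) ->
  `|family_min hp F - family_min hp G| <= D.
Proof.
move=> FG; rewrite ler_distlC; apply/andP; split.
  apply: le_family_min => i.
  have := FG i; rewrite ler_norml => /andP[_ +]; have := family_min_le F i; lra.
rewrite -lerBlDr; apply: le_family_min => i.
have := FG i; rewrite ler_norml => /andP[+ _]; have := family_min_le G i; lra.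
Qed.

End FamilyMin.

(** * The safety radius: sign, safety of the ball, Lipschitz bound *)

Section SafetyRadius.

Variables (R : realType) (n m p : nat) (hp : (0 < p)%N) (X : set 'cV[R]_n).
Variables (a : 'I_p -> 'cV[R]_n -> 'cV[R]_m) (b : 'I_p -> 'cV[R]_n -> R).
Variable pif : 'cV[R]_n -> 'cV[R]_m.

Lemma safety_radius_ge0 x : polyhedron a b x (pif x) ->
  0 <= safety_radius hp a b pif x.
Proof. move=> K; rewrite /safety_radius; apply: le_family_min => i.
by rewrite subr_ge0. Qed.

Lemma safety_ball_polyhedron x u : (forall i, enorm (a i x) = 1) ->
  enorm (u - pif x) <= safety_radius hp a b pif x -> polyhedron a b x u.
Proof.
move=> a1 ur i.
have := dotp_le (a i x) (u - pif x); rewrite a1 mul1r dotpDr dotpNr.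
have := family_min_le hp (fun i => b i x - dotp (a i x) (pif x)) i.
move: ur; rewrite /safety_radius /=; lra.
Qed.

Lemma safety_radius_lipschitz :
  (forall i, lipschitz_continuous_on X (a i)) ->
  (forall i, lipschitz_continuous_on X (fun x => (b i x)%:M : 'cV[R]_1)) ->
  (forall x i, X x -> enorm (a i x) = 1) ->
  lipschitz_continuous_on X pif ->
  (exists2 U, 0 < U & forall x, X x -> enorm (pif x) <= U) ->
  exists2 L, 0 <= L & forall x y, X x -> X y ->
    `|safety_radius hp a b pif x - safety_radius hp a b pif y|
      <= L * enorm (x - y).
Proof.
move=> a_lip b_lip a1 [Lf Lf0 f_lip] [U U0 fU].
have /choice [L LP] : forall i, exists L, 0 <= L /\ forall x y, X x -> X y ->
    `|(b i x - dotp (a i x) (pif x)) - (b i y - dotp (a i y) (pif y))|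
      <= L * enorm (x - y).
  move=> i; have [La La0 aL] := a_lip i; have [Lb Lb0 bL] := b_lip i.
  (* [La * U] pays for the change of [a i] against the bounded [pif], [Lf] for the change of [pif]
     against the unit vector [a i y]. *)
  exists (Lb + (La * U + Lf)); split; first by rewrite !addr_ge0 ?mulr_ge0 ?(ltW U0).
  move=> x y Xx Xy.
  have -> : (b i x - dotp (a i x) (pif x)) - (b i y - dotp (a i y) (pif y))
      = (b i x - b i y)
        - (dotp (a i x - a i y) (pif x) + dotp (a i y) (pif x - pif y)).
    by rewrite !dotp_lin; ring.
  apply: le_trans (ler_normB _ _) _; rewrite mulrDl; apply: lerD.
    by have := bL x y Xx Xy; rewrite -raddfB enorm_scalar.
  apply: le_trans (ler_normD _ _) _; rewrite mulrDl; apply: lerD.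
    apply: le_trans (normr_dotp_le _ _) _; rewrite mulrAC.
    by apply: ler_pM; rewrite ?enorm_ge0 ?aL ?fU.
  apply: le_trans (normr_dotp_le _ _) _.
  by rewrite a1 // mul1r f_lip.
(* The constants being nonnegative, their sum dominates each of them. *)
exists (\sum_i L i); first by apply: sumr_ge0 => i _; case: (LP i).
move=> x y Xx Xy; apply: family_min_dist => i.
have [_ /(_ x y Xx Xy) Li] := LP i; apply: le_trans Li _.
rewrite ler_wpM2r ?enorm_ge0 // (bigD1 i) //= lerDl.
by apply: sumr_ge0 => j _; case: (LP j).
Qed.

End SafetyRadius.

(** * The explicit solution of (P) *)

Section SocpController.

Variables (R : realType) (n m p : nat) (hp : (0 < p)%N).
Variables (a : 'I_p -> 'cV[R]_n -> 'cV[R]_m) (b : 'I_p -> 'cV[R]_n -> R).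
Variables pif pides : 'cV[R]_n -> 'cV[R]_m.

Definition socp_controller x :=
  pif x + ball_proj (safety_radius hp a b pif x) (pides x - pif x).

Lemma socp_controller_dist x v : 0 <= safety_radius hp a b pif x ->
  enorm (v - pif x) <= safety_radius hp a b pif x ->
  enorm (socp_controller x - pides x) ^+ 2
    + enorm (v - socp_controller x) ^+ 2 <= enorm (v - pides x) ^+ 2.
Proof.
move=> r0 vr; have := ball_proj_dist (pides x - pif x) r0 vr.
rewrite /socp_controller; move: (ball_proj _ _) => q.
by rewrite !opprB !addrA subrK [q + _]addrC -!addrA opprD.
Qed.

Lemma socp_controller_minimizer x : 0 <= safety_radius hp a b pif x ->
  socp_minimizer hp a b pif pides x (socp_controller x).
Proof.
move=> r0; split=> [|v vr].
  by rewrite /= /socp_controller addrC addKr ball_proj_norm.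
by apply: le_trans (socp_controller_dist r0 vr); rewrite lerDl sqr_ge0.
Qed.

Lemma socp_minimizer_unique x u : 0 <= safety_radius hp a b pif x ->
  socp_minimizer hp a b pif pides x u -> socp_controller x = u.
Proof.
move=> r0 [/= ur umin]; have [/= cr _] := socp_controller_minimizer r0.
have := socp_controller_dist r0 ur; have := umin _ cr => h1 h2.
(* Minimality of [u] against the controller leaves no room for the extra square. *)
have : enorm (u - socp_controller x) ^+ 2 <= 0 by move: h1 h2; lra.
rewrite le_eqVlt ltNge sqr_ge0 orbF sqrf_eq0 => /eqP /enorm_eq0 /eqP.
by rewrite subr_eq0 => /eqP.
Qed.

End SocpController.

Theorem theorem1 (R : realType) (m n p : nat)
    (hm : (0 < m)%N) (hn : (0 < n)%N) (hp : (0 < p)%N)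
    (X : set 'cV[R]_n)
    (a : 'I_p -> 'cV[R]_n -> 'cV[R]_m) (b : 'I_p -> 'cV[R]_n -> R)
    (pides pif : 'cV[R]_n -> 'cV[R]_m)
    (a_lip : forall i : 'I_p, lipschitz_continuous_on X (a i))
    (b_lip : forall i : 'I_p,
      lipschitz_continuous_on X (fun x => (b i x)%:M : 'cV[R]_1))
    (pides_lip : lipschitz_continuous_on X pides)
    (a_unit : forall (x : 'cV[R]_n) (i : 'I_p), X x -> enorm (a i x) = 1)
    (pif_lip : lipschitz_continuous_on X pif)
    (pif_K : forall x : 'cV[R]_n, X x -> polyhedron a b x (pif x))
    (pif_bounded : exists2 Uf : R, 0 < Uf &
      forall x : 'cV[R]_n, X x -> enorm (pif x) <= Uf) :
  (forall x : 'cV[R]_n, X x ->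
     exists! u : 'cV[R]_m, socp_minimizer hp a b pif pides x u) /\
  exists pisocp : 'cV[R]_n -> 'cV[R]_m,
    [/\ forall x : 'cV[R]_n, X x ->
          socp_minimizer hp a b pif pides x (pisocp x),
        forall x : 'cV[R]_n, X x -> polyhedron a b x (pisocp x)
      & lipschitz_continuous_on X pisocp].
Proof.
have r0 x : X x -> 0 <= safety_radius hp a b pif x.
  by move=> Xx; apply: safety_radius_ge0; exact: pif_K.
have min x : X x -> socp_minimizer hp a b pif pides x
    (socp_controller hp a b pif pides x).
  by move=> Xx; apply: socp_controller_minimizer; exact: r0.
split=> [x Xx|].
  exists (socp_controller hp a b pif pides x); split; first exact: min.
  by move=> u; apply: socp_minimizer_unique; exact: r0.
exists (socp_controller hp a b pif pides); split=> // [x Xx|].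
  have [ball _] := min x Xx.
  by apply: safety_ball_polyhedron ball => i; exact: a_unit.
have [Lr Lr0 rL] :=
  safety_radius_lipschitz hp a_lip b_lip a_unit pif_lip pif_bounded.
have [Lf Lf0 fL] := pif_lip; have [Ld Ld0 dL] := pides_lip.
(* [Lf] for the moving centre, [Ld + Lf] for the projected vector [pides x - pif x], [Lr] for the
   radius. *)
exists (Lf + (Ld + Lf + Lr)); first by rewrite !addr_ge0.
move=> x y Xx Xy; rewrite /socp_controller opprD addrACA.
apply: le_trans (enormD _ _) _; rewrite mulrDl lerD ?fL //.
apply: le_trans (ball_proj_lipschitz _ _ (r0 x Xx) (r0 y Xy)) _.
rewrite mulrDl lerD ?rL // opprD addrACA -opprD.
apply: le_trans (enormD _ _) _.
by rewrite enormN mulrDl lerD ?fL ?dL.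
Qed.
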